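(* Let $\mathcal{M}=(E_t,\mathcal{T})$ be a simple oriented matroid of rank at least $2$ on the ground set $E_t=\{1,\ldots,t\}$ with set of topes $\mathcal{T}\subset\{-1,1\}^t\subset\mathbb{R}^t$. Let $\boldsymbol{R}=(R^0,R^1,\ldots,R^{2t-1},R^0)$ be a symmetric cycle in the tope graph of $\mathcal{M}$, with vertex set $\mathfrak{V}(\boldsymbol{R})=\{R^0,R^1,\ldots,R^{2t-1}\}$. Let $B\in\mathcal{T}$ be any tope, and consider $\mathfrak{V}(\boldsymbol{R})$ as a subposet of the tope poset $\mathcal{T}(\mathcal{L}(\mathcal{M}),B)$ of $\mathcal{M}$ based at $B$. Let $\mathbf{min}\,\mathfrak{V}(\boldsymbol{R})$ be the set of minimal elements of this subposet, and let $\boldsymbol{Q}(B,\boldsymbol{R})$ be the unique inclusion-minimal subset of $\mathfrak{V}(\boldsymbol{R})$ whose elements sum to $B$ in $\mathbb{R}^t$. Then $$\boldsymbol{Q}(B,\boldsymbol{R})=\mathbf{min}\,\mathfrak{V}(\boldsymbol{R});$$ therefore $$B=\sum_{Q\in\mathbf{min}\,\mathfrak{V}(\boldsymbol{R})}Q .$$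
   Context: An oriented matroid on $E_t=\{1,\ldots,t\}$ is called simple if it has no loops and no parallel or antiparallel elements. Its topes are its maximal covectors; the signs $-$ and $+$ are replaced by the real numbers $-1$ and $1$, so each tope $T=(T(1),\ldots,T(t))$ is regarded as a vector in $\{-1,1\}^t\subset\mathbb{R}^t$ (there are no zero components, since there are no loops). Sums of topes are taken in $\mathbb{R}^t$. The separation set of topes $T',T''$ is $\mathbf{S}(T',T'')=\{e\in E_t: T'(e)\neq T''(e)\}$. The tope graph of $\mathcal{M}$ has vertex set $\mathcal{T}$; two topes form an edge (are adjacent) if they cover a common subtope in the big face lattice of $\mathcal{M}$. For a simple oriented matroid, the graph distance between $T'$ and $T''$ in the tope graph equals $|\mathbf{S}(T',T'')|$; in particular, $T',T''$ are adjacent iff $|\mathbf{S}(T',T'')|=1$. For $B\in\mathcal{T}$, the tope poset $\mathcal{T}(\mathcal{L}(\mathcal{M}),B)$ based at $B$ is the set $\mathcal{T}$ partially ordered by $T'\preceq T''$ iff $\mathbf{S}(B,T')\subseteq\mathbf{S}(B,T'')$. A symmetric cycle $\boldsymbol{R}=(R^0,R^1,\ldots,R^{2t-1},R^0)$ in the tope graph is a cycle of $2t$ topes, consecutive ones being adjacent, such that $R^{k+t}=-R^k$ for $0\le k\le t-1$; equivalently, $R^0,R^1,\ldots,R^t=-R^0$ is a maximal chain $\mathbf{m}$ in the tope poset based at $R^0$, and $\mathfrak{V}(\boldsymbol{R})=\mathbf{m}\cup(-\mathbf{m})$. The base tope $B$ of the theorem need not belong to $\mathfrak{V}(\boldsymbol{R})$.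 The vectors $R^0,\ldots,R^{t-1}$ form a basis of $\mathbb{R}^t$. For every tope $T\in\mathcal{T}$, the unique row vector $\boldsymbol{x}=(x_1,\ldots,x_t)$ with $T=\sum_{i=1}^t x_iR^{i-1}$ has all components in $\{-1,0,1\}$. It is known that for every tope $T$ there is a unique inclusion-minimal subset $\boldsymbol{Q}(T,\boldsymbol{R})\subset\mathfrak{V}(\boldsymbol{R})$ such that $T=\sum_{Q\in\boldsymbol{Q}(T,\boldsymbol{R})}Q$, namely $\boldsymbol{Q}(T,\boldsymbol{R})=\{x_i\cdot R^{i-1}: x_i\neq0\}$. *)

(* Defs.v *)
From HB Require Import structures.
From mathcomp Require Import all_boot all_order all_algebra.
From mathcomp Require Import reals.

Set Implicit Arguments.
Unset Strict Implicit.
Unset Printing Implicit Defensive.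

Import GRing.Theory.

(* Oriented matroids are given by their covectors. The ground set {1, ..., t}
   is represented by 'I_t. *)

Inductive sign := Neg | Zero | Pos.

Definition sign_code (s : sign) : option bool :=
  match s with Neg => Some false | Zero => None | Pos => Some true end.

Definition sign_decode (o : option bool) : sign :=
  match o with Some false => Neg | None => Zero | Some true => Pos end.

Lemma sign_codeK : cancel sign_code sign_decode.
Proof. by case. Qed.

HB.instance Definition _ := Finite.copy sign (can_type sign_codeK).

Definition sign_opp (s : sign) : sign :=
  match s with Neg => Pos | Zero => Zero | Pos => Neg end.

Notation signvec t := {ffun 'I_t -> sign}.

Section SignVectors.
Variable t : nat.
Implicit Types X Y : signvec t.

Definition sv0 : signvec t := [ffun=> Zero].

Definition sv_opp X : signvec t := [ffun e => sign_opp (X e)].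

Definition sv_comp X Y : signvec t :=
  [ffun e => if X e == Zero then Y e else X e].

(* Unlike sepset below, this ignores the elements where X or Y vanishes. *)
Definition sv_sep X Y : {set 'I_t} :=
  [set e | (X e != Zero) && (Y e == sign_opp (X e))].

(* The componentwise order induced by 0 < + and 0 < -. *)
Definition sv_le X Y : bool := [forall e, (X e == Zero) || (X e == Y e)].

Definition sv_lt X Y : bool := (X != Y) && sv_le X Y.

End SignVectors.

Arguments sv0 {t}.

Record oriented_matroid (t : nat) := OrientedMatroid {
  covectors : {set signvec t};
  covector0 : sv0 \in covectors;
  covector_opp : forall X, X \in covectors -> sv_opp X \in covectors;
  covector_comp : forall X Y,
    X \in covectors -> Y \in covectors -> sv_comp X Y \in covectors;
  covector_elim : forall X Y e,
    X \in covectors -> Y \in covectors -> e \in sv_sep X Y ->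
    exists Z, [/\ Z \in covectors, Z e = Zero &
      forall f, f \notin sv_sep X Y -> Z f = sv_comp X Y f]
}.

Section OrientedMatroids.
Variables (t : nat) (M : oriented_matroid t).
Implicit Types (X Y F T B : signvec t) (e f : 'I_t).

Definition is_loop e : Prop := forall X, X \in covectors M -> X e = Zero.

Definition are_parallel e f : Prop :=
  [/\ ~ is_loop e, ~ is_loop f & forall X, X \in covectors M -> X e = X f].

Definition are_antiparallel e f : Prop :=
  [/\ ~ is_loop e, ~ is_loop f &
      forall X, X \in covectors M -> X e = sign_opp (X f)].

Definition is_simple : Prop :=
  (forall e, ~ is_loop e) /\
  (forall e f, e != f -> ~ are_parallel e f /\ ~ are_antiparallel e f).

Definition is_chain (C : {set signvec t}) : bool :=
  [forall X in C, forall Y in C, sv_le X Y || sv_le Y X].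

(* Maximal chains of covectors run from sv0 to a tope and have rank + 1
   elements: adding the top element to the covectors yields the big face
   lattice, which is graded of length rank + 1. *)
Definition om_rank : nat :=
  \max_(C : {set signvec t} | (C \subset covectors M) && is_chain C) #|C|.-1.

Definition topes : {set signvec t} :=
  [set T in covectors M |
    [forall X in covectors M, sv_le T X ==> (X == T)]].

Definition om_covers X Y : bool :=
  sv_lt X Y && [forall Z in covectors M, ~~ (sv_lt X Z && sv_lt Z Y)].

(* The common covector F covered by two topes is their common subtope. *)
Definition tope_adj T1 T2 : bool :=
  [&& T1 \in topes, T2 \in topes, T1 != T2 &
      [exists F in covectors M, om_covers F T1 && om_covers F T2]].

Definition sepset T1 T2 : {set 'I_t} := [set e | T1 e != T2 e].

Definition tope_le B T1 T2 : bool := sepset B T1 \subset sepset B T2.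

Definition tope_min B (V : {set signvec t}) : {set signvec t} :=
  [set T in V | [forall T' in V, tope_le B T' T ==> (T' == T)]].

Definition symmetric_cycle (C : (2 * t).-tuple (signvec t)) : Prop :=
  ucycle tope_adj C /\
  (forall k : nat, k < t -> nth sv0 C (k + t) = sv_opp (nth sv0 C k)).

Definition cycle_vertices (C : (2 * t).-tuple (signvec t)) : {set signvec t} :=
  [set T in C].

End OrientedMatroids.

Section RealVectors.
Local Open Scope ring_scope.
Variables (R : realType) (t : nat).

Definition sign_val (s : sign) : R :=
  match s with Neg => -1 | Zero => 0 | Pos => 1 end.

Definition sv_vec (T : signvec t) : 'rV[R]_t := \row_e sign_val (T e).

Definition minimal_decomposition
    (V : {set signvec t}) (B : signvec t) (Q : {set signvec t}) : bool :=
  minset (fun A : {set signvec t} =>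
    (A \subset V) && (\sum_(T in A) sv_vec T == sv_vec B)) Q.

End RealVectors.

(* Main.v *)
Require Import Defs.
From HB Require Import structures.
From mathcomp Require Import all_boot all_order all_algebra.
From mathcomp Require Import reals.
From mathcomp Require Import zify ring lra.

(** Write [R^(k+1)] as [R^k] with the sign of a single element [e_k] flipped;
    this uses simplicity. Since [R^(k+t) = - R^k], any [t] consecutive flips hit
    every element exactly once, hence [R^k] is the only vertex of the cycle
    having its signs at [e_(k-1)] and [e_k]. Consequently [R^k] is minimal as
    soon as it agrees with [B] at these two elements, and it then occurs in
    every decomposition of [B]: the functional
    [X |-> R^k(e_(k-1)) X(e_(k-1)) + R^k(e_k) X(e_k)] takes the value [2] at [B]
    and is nonpositive at all other vertices. That the minimal vertices sum to
    [B] is a summation by parts, with the coefficients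
    [s_k = B(e_k) R^(k+1)(e_k)]. *)

Set Implicit Arguments.
Unset Strict Implicit.
Unset Printing Implicit Defensive.

Import GRing.Theory Num.Theory.

(** * Signs *)

Lemma sign_oppK : involutive sign_opp.
Proof. by case. Qed.

Lemma sign_opp_id x : (sign_opp x == x) = (x == Zero).
Proof. by case: x; apply/eqP/eqP. Qed.

Lemma sign_neq_opp x y : x != Zero -> y != Zero -> (x != y) = (x == sign_opp y).
Proof. by case: x; case: y => // _ _; apply/eqP/eqP. Qed.

Lemma sv_oppK t : involutive (@sv_opp t).
Proof. by move=> X; apply/ffunP => f; rewrite !ffunE sign_oppK. Qed.

(** * Adjacent topes of a simple oriented matroid *)

Section Topes.
Variables (t : nat) (M : oriented_matroid t).
Implicit Types (X Y F T : signvec t).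

(** By maximality, composing [T] with any covector [X] gives back [T], so every [X] vanishes where
    [T] does; such an element would be a loop. *)
Lemma tope_neq0 T e : is_simple M -> T \in topes M -> T e != Zero.
Proof.
move=> [noloop _]; rewrite inE => /andP[TM /forall_inP Tmax].
apply/eqP => Te0; apply: (noloop e) => X XM.
have /eqP eqT : sv_comp T X == T.
  apply: (implyP (Tmax _ (covector_comp TM XM))).
  by apply/forallP => f; rewrite ffunE; case: eqP => //= _; rewrite eqxx.
by move/ffunP/(_ e): eqT; rewrite ffunE Te0 eqxx.
Qed.

(* Eliminating an element separating [X] from [T] yields a covector to
   which induction applies and which hence vanishes on the zero set of
   [F]; so no element of the zero set is left unseparated. *)
Lemma covector_over_subtope F T X :
    T \in covectors M -> (forall e, T e != Zero) -> om_covers M F T ->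
    X \in covectors M -> sv_le F X ->
  [\/ forall e, F e = Zero -> X e = Zero,
      forall e, F e = Zero -> X e = T e
    | forall e, F e = Zero -> X e = sign_opp (T e)].
Proof.
move=> TM T0 /andP[/andP[_ /forallP FT] /forall_inP FTcov].
have [n] := ubnP #|sv_sep X T|; elim: n X => // n IHn X lt_n XM FX.
have sepP e : e \in sv_sep X T -> F e = Zero.
  rewrite inE => /andP[X0 /eqP TX]; move/forallP/(_ e): FX.
  case/orP=> /eqP // FXe; move: (FT e); rewrite FXe TX (negPf X0) /=.
  by rewrite eq_sym sign_opp_id (negPf X0).
have [sep0 | [e eXT]] := set_0Vmem (sv_sep X T).
  have XT : sv_le X T.
    apply/forallP => f; case: (altP eqP) => //= Xf0.
    move/setP/(_ f): sep0; rewrite !inE Xf0 /= -sign_neq_opp // => /negbFE.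
    by rewrite eq_sym.
  (* With nothing left to separate, [X] lies between [F] and [T], so the covering relation forces
     [X = F] or [X = T]. *)
  move: (FTcov X XM); rewrite /sv_lt FX XT !andbT negb_and !negbK.
  by case/orP=> /eqP <-; [constructor 1 | constructor 2].
have [Z [ZM Ze0 ZXT]] := covector_elim XM TM eXT.
have ZE f : f \notin sv_sep X T -> Z f = if X f == Zero then T f else X f.
  by move/ZXT; rewrite ffunE.
have FZ : sv_le F Z.
  apply/forallP => f; case: (altP eqP) => //= Ff0.
  have /ZE -> : f \notin sv_sep X T by apply: contraNN Ff0 => /sepP/eqP.
  move/forallP/(_ f): FX; rewrite (negPf Ff0) /= => /eqP <-.
  by rewrite (negPf Ff0) eqxx.
have lt_sep : #|sv_sep Z T| < n.
  apply: leq_trans (_ : #|sv_sep X T| <= n) => //; apply: proper_card.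
  apply/properP; split; last by exists e; rewrite // inE Ze0 eqxx.
  apply/subsetP => f; rewrite [_ \in sv_sep Z T]inE => /andP[Zf TZ].
  case: (boolP (f \in _)) => // /[dup] fXT /ZE Zf_eq.
  move: Zf TZ fXT; rewrite Zf_eq inE; case: (eqVneq (X f) Zero) => [_ _ | _ _ -> //].
  by rewrite eq_sym sign_opp_id (negPf (T0 f)).
have {}FeZ f : F f = Zero -> Z f = Zero.
  have Fe0 := sepP e eXT.
  case: (IHn Z lt_sep ZM FZ) => [|/(_ e Fe0)|/(_ e Fe0)]; first exact.
    by move/eqP; rewrite Ze0 eq_sym (negPf (T0 e)).
  by rewrite Ze0; case: (T e) (T0 e).
constructor 3 => f Ff0; case: (boolP (f \in sv_sep X T)).
  by rewrite inE => /andP[_ /eqP ->]; rewrite sign_oppK.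
move/ZE; rewrite (FeZ f Ff0); case: (altP eqP) => [_ | X0 XZ].
  by move/esym/eqP; rewrite (negPf (T0 f)).
by rewrite -XZ in X0.
Qed.

(** For every covector [X], the composition of [F] with [X] lies above [F] and equals [X] at the
    zeros of [F]. By the trichotomy, [X] is zero, [T] or [- T] at both elements simultaneously, so
    distinct [e] and [f] would be parallel or antiparallel. *)
Lemma subtope_zeros F T e f :
    is_simple M -> F \in covectors M -> T \in topes M -> om_covers M F T ->
  F e = Zero -> F f = Zero -> e = f.
Proof.
move=> simpleM FM Ttope FcovT Fe0 Ff0; apply/eqP/negPn/negP => neq_ef.
have TM : T \in covectors M by move: Ttope; rewrite inE => /andP[].
have T0 g : T g != Zero by apply: tope_neq0.
have [noloop /(_ e f neq_ef)[npar nanti]] := simpleM.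
have signs X : X \in covectors M ->
    [\/ X e = Zero /\ X f = Zero, X e = T e /\ X f = T f
      | X e = sign_opp (T e) /\ X f = sign_opp (T f)].
  move=> XM; have FX : sv_le F (sv_comp F X).
    by apply/forallP => g; rewrite ffunE; case: eqP => //=; rewrite eqxx.
  have FXM := covector_comp FM XM.
  have [H | H | H] := covector_over_subtope TM T0 FcovT FXM FX;
    move: (H e Fe0) (H f Ff0); rewrite !ffunE Fe0 Ff0 eqxx => -> ->;
    by [constructor 1 | constructor 2 | constructor 3].
have [eqT | ] := eqVneq (T e) (T f).
  apply: npar; split=> // X /signs.
  by case=> [] [-> ->] //; rewrite eqT.
rewrite sign_neq_opp // => /eqP eqT; apply: nanti; split=> // X /signs.
by case=> [] [-> ->] //; rewrite eqT.
Qed.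

(** Both topes agree with the common subtope off its zero set, and that set has only one element. *)
Lemma tope_adj_flip T1 T2 : is_simple M -> tope_adj M T1 T2 ->
  exists e, forall f, T2 f = if f == e then sign_opp (T1 f) else T1 f.
Proof.
move=> simpleM /and4P[T1t T2t neqT /exists_inP[F FM /andP[F1 F2]]].
have [e neq_e] : exists e, T1 e != T2 e.
  apply/existsP; rewrite -negb_forall; apply: contraNN neqT => /forallP eqT.
  by apply/eqP/ffunP => e; apply/eqP.
have F0 f : T1 f != T2 f -> F f = Zero.
  case/andP: F1 => /andP[_ /forallP/(_ f) le1] _.
  case/andP: F2 => /andP[_ /forallP/(_ f) le2] _.
  case/orP: le1 => /eqP // <-; case/orP: le2 => /eqP // <-.
  by rewrite eqxx.
exists e => f; have [-> | neq_fe] := eqVneq f e.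
  by apply/eqP; rewrite -sign_neq_opp ?(tope_neq0 _ simpleM) // eq_sym.
apply/esym/eqP; apply: contraNT neq_fe => neq_f.
by rewrite (subtope_zeros simpleM FM T1t F1 (F0 f neq_f) (F0 e neq_e)).
Qed.

End Topes.

(** * Antipodal walks that flip one sign per step *)

Section FlipWalk.
Variables (t : nat) (r : nat -> signvec t) (e : nat -> 'I_t).
Hypothesis r_neq0 : forall k f, r k f != Zero.
Hypothesis r_flip : forall k f,
  r k.+1 f = if f == e k then sign_opp (r k f) else r k f.
Hypothesis r_half : forall k, r (k + t) = sv_opp (r k).

Let V : {set signvec t} := [set r (val i) | i : 'I_(2 * t)].

Lemma walk_half k f : r (k + t) f = sign_opp (r k f).
Proof. by rewrite r_half ffunE. Qed.

Lemma walk_period n q : r (n + q * (2 * t)) = r n.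
Proof.
elim: q => [|q IHq]; first by rewrite addn0.
have -> : n + q.+1 * (2 * t) = n + q * (2 * t) + t + t by lia.
by rewrite !r_half sv_oppK.
Qed.

Lemma walk_pos : 0 < t.
Proof. by apply: leq_trans (ltn_ord (e 0)). Qed.

Lemma mem_walk n : r n \in V.
Proof.
have t2 : 0 < 2 * t by rewrite muln_gt0 walk_pos.
apply/imsetP; exists (Ordinal (ltn_pmod n t2)) => //=.
by rewrite {1}(divn_eq n (2 * t)) addnC walk_period.
Qed.

Lemma walkP k T : reflect (exists2 i, i < 2 * t & T = r (k + i)) (T \in V).
Proof.
have t2 : 0 < 2 * t by rewrite muln_gt0 walk_pos.
apply: (iffP idP) => [/imsetP[j _ ->] | [i _ ->]]; last exact: mem_walk.
(* The offset is [j - k] modulo the period; the added multiple of [2 * t] keeps the natural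
   subtraction from truncating. *)
exists ((j + k * (2 * t) - k) %% (2 * t)); first exact: ltn_pmod.
rewrite -[RHS](walk_period _ ((j + k * (2 * t) - k) %/ (2 * t))) -addnA.
rewrite [_ %% _ + _]addnC -divn_eq subnKC ?walk_period //.
by apply: leq_trans (leq_addl _ _); rewrite leq_pmulr.
Qed.

(** The sign at [e k] changes in step [k], hence by antipodality also in step [k + t], which flips a
    single element. *)
Lemma flip_half k : e (k + t) = e k.
Proof.
have := walk_half k.+1 (e k); rewrite addSn !r_flip !walk_half eqxx.
case: (altP eqP) => // _ /eqP; rewrite eq_sym sign_opp_id.
by case: (r k (e k)) (r_neq0 k (e k)).
Qed.

(** An element left alone for [t] steps would keep its sign, but [t] steps negate everything. *)
Lemma flip_surj k f : exists i : 'I_t, e (k + i) = f.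
Proof.
suff /existsP[i /eqP <-] : [exists i : 'I_t, e (k + i) == f] by exists i.
apply: contraT; rewrite negb_exists => /forallP no_f.
have fixf i : i <= t -> r (k + i) f = r k f.
  elim: i => [|i IHi] lt_it; first by rewrite addn0.
  rewrite addnS r_flip eq_sym -[i]/(val (Ordinal lt_it)) (negPf (no_f _)) /=.
  exact/IHi/ltnW.
move: (fixf t (leqnn _)); rewrite walk_half => /eqP.
by rewrite sign_opp_id (negPf (r_neq0 _ _)).
Qed.

Lemma flip_inj k : injective (fun i : 'I_t => e (k + i)).
Proof.
suff /image_injP inj : #|codom (fun i : 'I_t => e (k + i))| == #|'I_t|.
  by move=> i j; apply: inj.
rewrite -(eq_card (A := predT)) // => f; symmetry.
by have [i <-] := flip_surj k f; rewrite inE; apply: codom_f.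
Qed.

Lemma walk_same_sign k i : i < t -> r (k.+1 + i) (e k) = r k.+1 (e k).
Proof.
elim: i => [|i IHi] lt_it; first by rewrite addn0.
rewrite addnS r_flip IHi ?(ltnW lt_it) // addSnnS; case: eqP => // eq_e.
have := @flip_inj k (Ordinal walk_pos) (Ordinal lt_it).
by rewrite /= addn0 => /(_ eq_e) [].
Qed.

(** The sign at [e k] persists for [i < t] and is reversed for the rest of the period. The sign at
    [e k.+1] is reversed already at [i = 1] and stays so up to [i = t]. Only [i = 0] survives both
    conditions. *)
Lemma walk_two_signs k i : i < 2 * t ->
    r (k.+1 + i) (e k) = r k.+1 (e k) ->
    r (k.+1 + i) (e k.+1) = r k.+1 (e k.+1) ->
  i = 0.
Proof.
move=> lt_i2t eq1 eq2; have lt_it : i < t.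
  rewrite ltnNge; apply/negP => le_ti; move: eq1.
  rewrite -(subnK le_ti) addnA walk_half walk_same_sign; last by lia.
  by move/eqP; rewrite sign_opp_id (negPf (r_neq0 _ _)).
case: i => // i in lt_it eq2 {eq1 lt_i2t} *; move: eq2.
rewrite addnS -addSn walk_same_sign ?(ltnW lt_it) // r_flip eqxx => /eqP.
by rewrite sign_opp_id (negPf (r_neq0 _ _)).
Qed.

Lemma walk_two_signs_in k T : T \in V ->
  T (e k) = r k.+1 (e k) -> T (e k.+1) = r k.+1 (e k.+1) -> T = r k.+1.
Proof.
case/(walkP k.+1) => i lt_i -> eq1 eq2.
by rewrite (walk_two_signs lt_i eq1 eq2) addn0.
Qed.

Lemma walk_inj : injective (fun i : 'I_(2 * t) => r i.+1).
Proof.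
have le_inj (i j : 'I_(2 * t)) : i <= j -> r i.+1 = r j.+1 -> i = j.
  move=> le_ij eq_r; apply/val_inj => /=.
  suff : j - i = 0 by lia.
  apply: (@walk_two_signs i); rewrite ?addSn ?subnKC ?eq_r //.
  by have := ltn_ord j; lia.
by move=> i j eq_r; case/orP: (leq_total i j) => /le_inj -> //.
Qed.

(** * Minimal vertices relative to a base tope *)

Variable B : signvec t.
Hypothesis B_neq0 : forall f, B f != Zero.

(** Step [k] removes [e k] from the separation set with [B] when this holds, and adds it
    otherwise. *)
Let towards k := B (e k) == r k.+1 (e k).

Lemma towards_half k : towards (k + t) = ~~ towards k.
Proof.
by rewrite /towards -addSn walk_half flip_half sign_neq_opp.
Qed.

Lemma away_eq k : ~~ towards k -> B (e k) = r k (e k).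
Proof.
by rewrite /towards sign_neq_opp // r_flip eqxx sign_oppK => /eqP.
Qed.

Lemma walk_neqS k : r k != r k.+1.
Proof.
apply/eqP => /ffunP/(_ (e k)); rewrite r_flip eqxx => /esym/eqP.
by rewrite sign_opp_id (negPf (r_neq0 _ _)).
Qed.

(** Minimal vertices are the local minima of the walk: if the step in does not approach [B], or the
    step out does, then a neighbour lies strictly below. Conversely, a vertex below [r k.+1] agrees
    with [B] wherever [r k.+1] does, in particular at [e k] and [e k.+1], and these two signs
    determine it. *)
Lemma walk_min k :
  (r k.+1 \in tope_min B V) = towards k && ~~ towards k.+1.
Proof.
apply/idP/andP => [|[tk tk1]].
  rewrite inE => /andP[_ /forall_inP minr]; split.
    apply: contraT => /away_eq Bk; have /eqP : r k == r k.+1.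
      apply: (implyP (minr _ (mem_walk k))); apply/subsetP => f.
      by rewrite !inE r_flip; have [->|//] := eqVneq f (e k); rewrite Bk eqxx.
    by move/eqP; rewrite (negPf (walk_neqS k)).
  apply/negP => /eqP Bk; have : r k.+2 == r k.+1.
    apply: (implyP (minr _ (mem_walk k.+2))); apply/subsetP => f.
    rewrite !inE [in X in X -> _]r_flip; have [->|//] := eqVneq f (e k.+1).
    by rewrite Bk r_flip eqxx eqxx.
  by rewrite eq_sym (negPf (walk_neqS _)).
rewrite inE mem_walk; apply/forall_inP => T TV; apply/implyP => /subsetP leT.
have agree f : B f = r k.+1 f -> T f = r k.+1 f.
  move=> Bf; apply/eqP; rewrite -Bf eq_sym -[_ == _]negbK; apply/negP => neqT.
  by have := leT f; rewrite !inE Bf eqxx -Bf => /(_ neqT).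
by apply/eqP/(walk_two_signs_in TV); apply: agree; [apply/eqP | apply: away_eq].
Qed.

Lemma tope_min_walk :
  tope_min B V =
  [set r i.+1 | i : 'I_(2 * t) in [pred i : 'I__ | towards i && ~~ towards i.+1]].
Proof.
apply/setP => T; apply/idP/imsetP => [Tmin | [i tow_i ->]]; last first.
  by rewrite walk_min.
have TV : T \in V by move: Tmin; rewrite inE => /andP[].
(* Listing the vertices from index 1 puts each of them in the form [r i.+1]. *)
have [i lt_i eqT] := walkP 1 T TV; exists (Ordinal lt_i) => //=.
by rewrite inE -walk_min -[i.+1]add1n -eqT.
Qed.

(** * Decompositions of the base tope in real coordinates *)

Section Values.
Local Open Scope ring_scope.
Variable R : realType.

Let val_opp x : sign_val R (sign_opp x) = - sign_val R x.
Proof. by case: x; rewrite /= ?opprK ?oppr0. Qed.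

Let val_sqr x : x != Zero -> sign_val R x * sign_val R x = 1.
Proof. by case: x; rewrite //= ?mulrNN mulr1. Qed.

Lemma sum_tope_min : \sum_(T in tope_min B V) sv_vec R T = sv_vec R B.
Proof.
apply/rowP => f; rewrite summxE tope_min_walk big_imset /=; last first.
  by move=> i j _ _; apply: walk_inj.
pose x k : R := sign_val R (r k f).
pose s k : R := if towards k then 1 else -1.
have xhalf k : x (k + t)%N = - x k by rewrite /x walk_half val_opp.
have shalf k : s (k + t)%N = - s k.
  by rewrite /s towards_half; case: (towards k); rewrite ?opprK.
(* Coordinate [f] moves only when it is flipped, by twice the sign of [B] if the step approaches [B]
   and by the negative of that otherwise; [s k] corrects the direction. *)
have step k : s k * (x k.+1 - x k) = if f == e k then 2 * sign_val R (B f) else 0.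
  rewrite /x r_flip; case: eqP => [-> | _]; last by rewrite subrr mulr0.
  rewrite val_opp /s; case: (boolP (towards k)) => [/eqP|/away_eq] ->.
    by rewrite r_flip eqxx val_opp; ring.
  by ring.
have parts n : \sum_(k < n) (s k - s k.+1) * x k.+1 =
    \sum_(k < n) s k * (x k.+1 - x k) + (s 0%N * x 0%N - s n * x n).
  elim: n => [|n IHn]; first by rewrite !big_ord0; ring.
  by rewrite !big_ord_recr /= IHn; ring.
(* The boundary terms cancel because [s] and [x] both change sign after [t] steps, and [f] is
   flipped exactly once in these steps. *)
have sum2B : \sum_(k < t) (s k - s k.+1) * x k.+1 = 2 * sign_val R (B f).
  rewrite parts (shalf 0%N) (xhalf 0%N) mulrNN subrr addr0.
  have [i ei] := flip_surj 0 f.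
  rewrite (bigD1 i) //= step -ei eqxx big1 ?addr0 // => j neq_ji.
  rewrite step -ei; case: eqP => // /(@flip_inj 0) eq_ij.
  by rewrite eq_ij eqxx in neq_ji.
(* Pair [k] with [k + t], where [s] and [x] are negated. If [s k = s k.+1], neither index is
   selected; otherwise exactly one is, and it contributes half of [(s k - s k.+1) * x k.+1]. *)
have halves : \sum_(k < 2 * t | towards k && ~~ towards k.+1)
    sv_vec R (r k.+1) 0 f = 2^-1 * \sum_(k < t) (s k - s k.+1) * x k.+1.
  rewrite mulr_sumr big_mkcond /= mul2n -addnn big_split_ord /= -big_split /=.
  apply: eq_bigr => k _; rewrite addnC -addSn !towards_half !mxE.
  rewrite -/(x (k.+1 + t)%N) -/(x k.+1) xhalf /s.
  by case: (towards k); case: (towards k.+1) => /=; field.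
transitivity (2^-1 * (2 * sign_val R (B f))); last by rewrite !mxE; field.
by rewrite -sum2B -halves; apply: eq_bigl.
Qed.

Lemma tope_min_sub_decomposition (A : {set signvec t}) :
    A \subset V -> \sum_(T in A) sv_vec R T = sv_vec R B ->
  tope_min B V \subset A.
Proof.
move=> /subsetP sAV sumA; apply/subsetP => T; rewrite tope_min_walk.
case/imsetP=> k; rewrite inE => /andP[/eqP B1 /away_eq B2] ->.
apply: contraT => notA.
(* [B] and [r k.+1] agree at [e k] and [e k.+1], so the coefficients may be read from [B]. *)
pose phi (X : signvec t) := sign_val R (B (e k)) * sv_vec R X 0 (e k)
  + sign_val R (B (e k.+1)) * sv_vec R X 0 (e k.+1).
have sum_phi : \sum_(X in A) phi X = 2.
  rewrite big_split /= -!mulr_sumr -!summxE sumA !mxE !val_sqr //.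
have : \sum_(X in A) phi X <= 0.
  apply: sumr_le0 => X XA; rewrite /phi !mxE.
  have XV := sAV _ XA; have X0 f : X f != Zero by case/imsetP: XV => i _ ->.
  (* Agreement at both elements would make [X] the excluded vertex [r k.+1]; hence at least one term
     of [phi X] is [-1]. *)
  have : ~~ ((X (e k) == B (e k)) && (X (e k.+1) == B (e k.+1))).
    apply: contraNN notA => /andP[/eqP X1 /eqP X2].
    by rewrite -(@walk_two_signs_in k X) // ?X1 ?X2.
  move: (B_neq0 (e k)) (B_neq0 (e k.+1)) (X0 (e k)) (X0 (e k.+1)).
  by case: (B (e k)); case: (B (e k.+1)); case: (X (e k)); case: (X (e k.+1));
    rewrite //= => *; lra.
by rewrite sum_phi lern0.
Qed.

(** The set of minimal vertices is itself a decomposition and is contained in every other one, so it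
    is the only inclusion-minimal one. *)
Lemma minimal_decomposition_walk (Q : {set signvec t}) :
  minimal_decomposition R V B Q <-> Q = tope_min B V.
Proof.
have minV : tope_min B V \subset V by apply/subsetP => T; rewrite inE => /andP[].
split=> [/minsetP[/andP[sQV /eqP sumQ] Qmin] | ->].
  apply/esym/Qmin; first by rewrite minV sum_tope_min eqxx.
  exact: tope_min_sub_decomposition.
apply/minsetP; split=> [|A /andP[sAV /eqP sumA] sAmin].
  by rewrite minV sum_tope_min eqxx.
by apply/eqP; rewrite eqEsubset sAmin tope_min_sub_decomposition.
Qed.

End Values.
End FlipWalk.

(** * Symmetric cycles as antipodal flip walks *)

Lemma om_rank_empty (M : oriented_matroid 0) : om_rank M = 0.
Proof.
apply/eqP; rewrite -leqn0; apply/bigmax_leqP => C _.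
rewrite -subn1 leq_subLR; apply: leq_trans (max_card _) _.
by rewrite card_ffun card_ord.
Qed.

Lemma cycle_nth (T : Type) (adj : rel T) x0 (s : seq T) k :
  k < size s -> cycle adj s -> adj (nth x0 s k) (nth x0 s (k.+1 %% size s)).
Proof.
case: s => // x s lt_k /(pathP x0) /(_ k); rewrite size_rcons => /(_ lt_k).
rewrite -rcons_cons !nth_rcons lt_k /=.
move: lt_k; rewrite /= ltnS leq_eqVlt => /predU1P[-> | lt_k].
  by rewrite ltnn eqxx modnn.
by rewrite lt_k modn_small.
Qed.

Theorem theorem2p1 (R : realType) (t : nat) (M : oriented_matroid t)
    (hsimple : is_simple M) (hrank : 2 <= om_rank M)
    (C : (2 * t).-tuple (signvec t)) (hC : symmetric_cycle M C)
    (B : signvec t) (hB : B \in topes M) :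
  (forall Q : {set signvec t},
      minimal_decomposition R (cycle_vertices C) B Q <->
      Q = tope_min B (cycle_vertices C)) /\
  sv_vec R B =
    (\sum_(Q in tope_min B (cycle_vertices C)) sv_vec R Q)%R.
Proof.
have t_gt0 : 0 < t.
  by case: t M {hsimple C hC B hB} hrank => // M; rewrite om_rank_empty.
have t2_gt0 : 0 < 2 * t by rewrite muln_gt0.
case: hC => /andP[cycC _] halfC.
(* The cycle is unrolled periodically over all natural indices; the default [sv0] is never
   reached. *)
pose r k := nth sv0 C (k %% (2 * t)).
have r_adj k : tope_adj M (r k) (r k.+1).
  have := @cycle_nth _ _ sv0 C (k %% (2 * t)).
  rewrite size_tuple ltn_pmod // -[(_ %% _).+1]addn1 modnDml addn1.
  exact.
have r_neq0 k f : r k f != Zero.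
  by apply: tope_neq0 hsimple _; case/and4P: (r_adj k).
have r_half k : r (k + t) = sv_opp (r k).
  rewrite /r -modnDml; have := ltn_pmod k t2_gt0; move: (k %% _) => m lt_m.
  have [lt_mt | le_tm] := ltnP m t; first by rewrite modn_small ?halfC //; lia.
  (* The symmetry is given only for indices below [t]. In the second half, [r m] is the opposite of
     [r (m - t)], and [m + t] reduces to [m - t] modulo the period. *)
  rewrite -{2}(subnK le_tm) halfC; last by lia.
  have -> : m + t = m - t + 2 * t by lia.
  by rewrite modnDr modn_small ?sv_oppK //; lia.
have [e r_flip] : exists e : nat -> 'I_t, forall k f,
    r k.+1 f = if f == e k then sign_opp (r k f) else r k f.
  have ex k : exists e : 'I_t, [forall f,
      r k.+1 f == if f == e then sign_opp (r k f) else r k f].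
    have [e He] := tope_adj_flip hsimple (r_adj k).
    by exists e; apply/forallP => f; apply/eqP.
  exists (fun k => xchoose (ex k)) => k f.
  by apply/eqP; move: f; apply/forallP/(xchooseP (ex k)).
have B_neq0 f : B f != Zero by apply: tope_neq0 hsimple hB.
have -> : cycle_vertices C = [set r (val i) | i : 'I_(2 * t)].
  apply/setP => T; rewrite inE; apply/idP/imsetP => [TC | [i _ ->]].
    have lt_i : index T C < 2 * t by rewrite -[X in _ < X](size_tuple C) index_mem.
    by exists (Ordinal lt_i); rewrite //= /r modn_small // nth_index.
  by rewrite /r mem_nth // size_tuple ltn_pmod.
split=> [Q|]; first exact: minimal_decomposition_walk r_neq0 r_flip r_half _ _ _ _.
by rewrite (sum_tope_min r_neq0 r_flip r_half).
Qed.
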